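(* Let $F$ be a field of characteristic not two and let $E$ be a finite-dimensional vector space over $F$ with an arbitrary symmetric bilinear form $(U,V)\mapsto U\cdot V$. Suppose the non-null triangle $\overline{UVW}$ in $E$ has quadrances $Q_W=Q(U,V)$, $Q_U=Q(V,W)$, $Q_V=Q(U,W)$, and spreads $s_U=s(UV,UW)$, $s_V=s(VW,VU)$, $s_W=s(WU,WV)$. Then $$\frac{s_U}{Q_U}=\frac{s_V}{Q_V}=\frac{s_W}{Q_W}.$$
   Context: Elements of $E$ are called points or vectors. The quadrance between points $U$ and $V$ is $Q(U,V)=(V-U)\cdot(V-U)$. The line $UV$ through distinct points $U,V$ is null if $Q(U,V)=0$, and non-null otherwise. A triangle $\overline{UVW}$ is a set of three distinct non-collinear points; it is non-null when each of the lines $UV$, $VW$, $UW$ is non-null. The spread between non-null lines $UW$ and $VZ$ is $$s(UW,VZ)=1-\frac{\left((W-U)\cdot(Z-V)\right)^2}{Q(U,W)\,Q(V,Z)},$$ which depends only on the two lines. The bilinear form is not assumed non-degenerate. *)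

(* Defs.v *)
From mathcomp Require Import all_boot all_order all_algebra.
From mathcomp Require Import ring.

Set Implicit Arguments.
Unset Strict Implicit.
Unset Printing Implicit Defensive.
Import GRing.Theory.
Local Open Scope ring_scope.

Section RationalTrigonometry.

Variables (F : fieldType) (E : vectType F) (dot : {symmetric E}).
Implicit Types U V W Z : E.

Definition line U V : {pred E} := [pred X | X - U \in <[V - U]>%VS].

Definition collinear U V W : Prop :=
  exists A B, [/\ A != B, U \in line A B, V \in line A B & W \in line A B].

Definition quadrance U V : F := dot (V - U) (V - U).

(* The line is given by two distinct points on it; whether it is null does not
   depend on their choice, see null_line_line. *)
Definition null_line U V : bool := quadrance U V == 0.

(* The spread between the lines UW and VZ, both of which should be non-null;
   it depends only on the two lines, see spread_line. *)
Definition spread U W V Z : F :=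
  1 - dot (W - U) (Z - V) ^+ 2 / (quadrance U W * quadrance V Z).

Definition is_triangle U V W : Prop :=
  uniq [:: U; V; W] /\ ~ collinear U V W.

Definition nonnull_triangle U V W : Prop :=
  [/\ is_triangle U V W, ~~ null_line U V, ~~ null_line V W
    & ~~ null_line U W].

Lemma line_direction U V A B :
    A \in line U V -> B \in line U V -> A != B ->
  exists2 c : F, c != 0 & B - A = c *: (V - U).
Proof.
move=> /vlineP[a Aa] /vlineP[b Bb] neqAB.
have eqBA : B - A = (b - a) *: (V - U).
  by rewrite scalerBl -Aa -Bb opprB addrA subrK.
exists (b - a) => //; apply: contra_neq neqAB => c0.
by apply/esym/eqP; rewrite -subr_eq0 eqBA c0 scale0r.
Qed.

Lemma dotZ a b (X Y : E) : dot (a *: X) (b *: Y) = a * b * dot X Y.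
Proof. by rewrite linearZl_LR linearZr_LR /= mulrA. Qed.

Lemma null_line_line U V A B :
    A \in line U V -> B \in line U V -> A != B ->
  null_line A B = null_line U V.
Proof.
move=> lA lB /(line_direction lA lB)[c c0 eqBA].
by rewrite /null_line /quadrance eqBA dotZ !mulf_eq0 (negPf c0).
Qed.

Lemma spread_line U W V Z A B C D :
    ~~ null_line U W -> ~~ null_line V Z ->
    A \in line U W -> B \in line U W -> A != B ->
    C \in line V Z -> D \in line V Z -> C != D ->
  spread A B C D = spread U W V Z.
Proof.
rewrite /null_line /spread /quadrance => q1 q2 lA lB neqAB lC lD neqCD.
have [a a0 ->] := line_direction lA lB neqAB.
have [b b0 ->] := line_direction lC lD neqCD.
rewrite !dotZ; move: q1 q2; move: (dot (W - U) (W - U)) => p.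
move: (dot (Z - V) (Z - V)) (dot (W - U) (Z - V)) => q r p0 q0.
by field; rewrite a0 b0 p0 q0.
Qed.

End RationalTrigonometry.

(* Main.v *)
Require Import Defs.
From mathcomp Require Import all_boot all_order all_algebra.
From mathcomp Require Import ring.
Import GRing.Theory.
Local Open Scope ring_scope.

(** Each spread, divided by the opposite quadrance, is the same expression in
    the whole triangle.  Putting the spread at U over a common denominator
    gives [gram (V - U) (W - U) / (Q(U,V) Q(U,W))], where [gram] is the Gram
    determinant of the two edges leaving U; a further division by the opposite
    quadrance Q(V,W) makes the denominator the product of all three quadrances
    ([spread_div_quadrance]).  The numerator does not depend on the vertex
    either: the edges leaving V are obtained from those leaving U by a linear
    change of vectors of determinant 1, which preserves the Gram determinant
    ([gram_rotate]).  The ratio is therefore invariant under the cyclic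
    rotation of the vertices ([spread_div_quadrance_rotate]), and two rotations
    give the two equalities. *)

Section SpreadLaw.

Variables (F : fieldType) (E : vectType F) (dot : {symmetric E}).
Implicit Types X Y U V W : E.

Definition gram X Y : F := dot X X * dot Y Y - dot X Y ^+ 2.

Lemma dotC X Y : dot X Y = dot Y X.
Proof. by rewrite hermC expr0 mul1r. Qed.

Lemma quadranceC U V : quadrance dot U V = quadrance dot V U.
Proof. by rewrite /quadrance -(opprB U V) linearNl linearNr opprK. Qed.

(** Holds because the substitution (X, Y) |-> (Y - X, - X) has determinant 1,
    and a linear change of the two vectors multiplies [gram] by the square of
    its determinant. *)
Lemma gram_unimodular X Y : gram (Y - X) (- X) = gram X Y.
Proof.
rewrite /gram !linearBl !linearBr !linearNl !linearNr /= (dotC Y X).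
by ring.
Qed.

Lemma gram_rotate U V W : gram (W - V) (U - V) = gram (V - U) (W - U).
Proof. by rewrite -(gram_unimodular (V - U)) !opprB addrA subrK. Qed.

Lemma spread_div_quadrance U V W :
    ~~ null_line dot U V -> ~~ null_line dot V W -> ~~ null_line dot U W ->
  spread dot U V U W / quadrance dot V W =
  gram (V - U) (W - U)
    / (quadrance dot U V * quadrance dot V W * quadrance dot U W).
Proof.
rewrite /null_line /spread /gram -!/(quadrance dot U _).
move: (quadrance dot U V) (quadrance dot V W) (quadrance dot U W) => p q r.
by move=> p0 q0 r0; field; rewrite p0 q0 r0.
Qed.

Lemma spread_div_quadrance_rotate U V W :
    ~~ null_line dot U V -> ~~ null_line dot V W -> ~~ null_line dot U W ->
  spread dot U V U W / quadrance dot V W =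
  spread dot V W V U / quadrance dot U W.
Proof.
move=> UV VW UW; rewrite (quadranceC U W) !spread_div_quadrance //.
- rewrite (gram_rotate U) (quadranceC W U) (quadranceC V U).
  by congr (_ / _); ring.
- by rewrite /null_line quadranceC.
- by rewrite /null_line quadranceC.
Qed.

End SpreadLaw.

Theorem theorem3 (F : fieldType) (charF : 2%N \notin [pchar F])
    (E : vectType F) (dot : {symmetric E}) (U V W : E)
    (QU QV QW sU sV sW : F) :
  nonnull_triangle dot U V W ->
  QW = quadrance dot U V ->
  QU = quadrance dot V W ->
  QV = quadrance dot U W ->
  sU = spread dot U V U W ->
  sV = spread dot V W V U ->
  sW = spread dot W U W V ->
  sU / QU = sV / QV /\ sV / QV = sW / QW.
Proof.
move=> [_ UV VW UW] -> -> -> -> -> ->; split.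
  exact: spread_div_quadrance_rotate.
rewrite (quadranceC _ _ _ U W) (quadranceC _ _ _ U V).
by apply: spread_div_quadrance_rotate; rewrite // /null_line quadranceC.
Qed.
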